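(* Let $G$ be a graph on $n$ vertices with Laplacian matrix $L$, and let $k$ be an integer with $2\le k\le n$. Then the optimal value of the semidefinite program $$\max\ \tfrac12\operatorname{tr}(LY)\quad\text{subject to}\quad \operatorname{tr}(Y)=n,\quad kY-J_n\succeq 0,$$ where $Y$ ranges over real symmetric $n\times n$ matrices, is equal to $$\frac{n(k-1)}{2k}\,\lambda_{\max}(L),$$ where $\lambda_{\max}(L)$ is the largest eigenvalue of $L$.
   Context: Graphs are finite, simple and undirected (not necessarily connected). If $A$ is the adjacency matrix of $G$ and $u_n$ is the all-ones vector of length $n$, the Laplacian matrix is $L=\operatorname{Diag}(Au_n)-A$, where $\operatorname{Diag}(v)$ is the diagonal matrix with diagonal $v$. $J_n$ is the $n\times n$ all-ones matrix, and $M\succeq 0$ means that the symmetric matrix $M$ is positive semidefinite. *)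

(* Defs.v *)
From HB Require Import structures.
From mathcomp Require Import all_boot all_order all_algebra.
From mathcomp Require Import classical_sets reals.

Set Implicit Arguments.
Unset Strict Implicit.
Unset Printing Implicit Defensive.

Import Order.TTheory GRing.Theory Num.Theory.
Local Open Scope classical_set_scope.
Local Open Scope ring_scope.

(* A simple graph on n vertices is a symmetric irreflexive e : rel 'I_n. *)

Definition adjmx (R : realType) (n : nat) (e : rel 'I_n) : 'M[R]_n :=
  \matrix_(i, j) (e i j)%:R.

(* diag_mx expects a row vector, whence the transpose. *)
Definition laplacian (R : realType) (n : nat) (e : rel 'I_n) : 'M[R]_n :=
  diag_mx (adjmx R e *m (const_mx 1 : 'cV[R]_n))^T - adjmx R e.

Definition psdmx (R : realType) (n : nat) (M : 'M[R]_n) : Prop :=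
  M \is symmetricmx /\ forall x : 'cV[R]_n, 0 <= (x^T *m M *m x) 0 0.

(* sup is total: this is the largest eigenvalue as soon as M has an eigenvalue
   (the set is finite), in particular when M is symmetric and 0 < n. *)
Definition lambda_max (R : realType) (n : nat) (M : 'M[R]_n) : R :=
  sup [set a : R | eigenvalue M a].

Definition sdp_feasible (R : realType) (n k : nat) : set 'M[R]_n :=
  [set Y | [/\ Y \is symmetricmx, \tr Y = n%:R
             & psdmx (k%:R *: Y - const_mx 1)]].

Definition sdp_values (R : realType) (n k : nat) (L : 'M[R]_n) : set R :=
  [set 2^-1 * \tr (L *m Y) | Y in @sdp_feasible R n k].

Definition is_max (R : realType) (S : set R) (v : R) : Prop :=
  S v /\ ubound S v.

(* Main.v *)
Require Import Defs.
From HB Require Import structures.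
From mathcomp Require Import all_boot all_order all_algebra.
From mathcomp Require Import classical_sets reals.
From mathcomp Require Import ring.
From mathcomp Require complex.

(* Substituting Y = (J + Z) / k turns the feasible set into the psd matrices Z
   of trace n (k - 1), and the objective into tr (L Z) / (2 k), because L J = 0.
   By the spectral theorem tr (L Z) <= lambda_max(L) tr Z for psd Z, with
   equality when Z is a multiple of v^T v for an eigenvector v of lambda_max(L).
   The spectral theorem is taken over R[i]: writing L = P^-1 diag(d) P with P
   unitary gives tr (L Z) = sum_i d_i q_i and tr Z = sum_i q_i, where
   q_i = (P Z P^-1)_ii >= 0. *)

Set Implicit Arguments.
Unset Strict Implicit.
Unset Printing Implicit Defensive.

Import Order.TTheory GRing.Theory Num.Theory.
Local Open Scope ring_scope.

Lemma symmetricmxE (F : fieldType) (n : nat) (A : 'M[F]_n) :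
  (A \is symmetricmx) = (A == A^T).
Proof. by rewrite is_hermitianmxE expr0 scale1r map_mx_id. Qed.

Section Spectral.
Import complex.

(** Write w = a + ib with a, b real. Since Z is real, the cross terms between a and b are purely
    imaginary, so only the real forms of Z at a and at b survive. *)
Lemma Re_hermitian_form_ge0 (R : rcfType) (n : nat) (Z : 'M[R]_n) :
  (forall x : 'cV[R]_n, 0 <= (x^T *m Z *m x) 0 0) ->
  forall w : 'rV[R[i]]_n,
  0 <= Re ((w *m map_mx (real_complex R) Z *m (map_mx Num.conj w)^T) 0 0).
Proof.
move=> Zpos w.
have -> : Re ((w *m map_mx (real_complex R) Z *m (map_mx Num.conj w)^T) 0 0)
  = ((map_mx (@Re R) w) *m Z *m (map_mx (@Re R) w)^T) 0 0
    + ((map_mx (@Im R) w) *m Z *m (map_mx (@Im R) w)^T) 0 0.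
  rewrite !mxE (raddf_sum (@Re R : Rcomplex R -> R)) -big_split /=.
  apply: eq_bigr => j _; rewrite !mxE !mulr_suml.
  rewrite (raddf_sum (@Re R : Rcomplex R -> R)) -big_split /=.
  apply: eq_bigr => l _; rewrite !mxE.
  case: (w 0 l) => a b; case: (w 0 j) => c d /=.
  by rewrite !mulr0 subr0 add0r mulrN opprK.
by rewrite addr_ge0 // -{1}[map_mx _ w]trmxK Zpos.
Qed.

(** The witness [a] is the largest of the finitely many spectral diagonal entries, so no supremum is
    involved yet. *)
Lemma symmetric_max_eigenvalue (R : rcfType) (n : nat) (A : 'M[R]_n) :
    (0 < n)%N -> A \is symmetricmx ->
  exists2 a : R, eigenvalue A a &
    forall Z : 'M[R]_n, (forall x : 'cV[R]_n, 0 <= (x^T *m Z *m x) 0 0) ->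
    \tr (A *m Z) <= a * \tr Z.
Proof.
move=> n_gt0 Asym; pose f := real_complex R; pose B := map_mx f A.
have Bherm : B \is hermitianmx _ false Num.conj.
  apply: realsym_hermsym.
    by move: Asym; rewrite !symmetricmxE => /eqP At; rewrite map_trmx -At.
  by apply/mxOverP => i j; rewrite mxE; apply/complex_realP; exists (A i j).
pose P := spectralmx B; pose d := spectral_diag B.
have PU : P \in unitmx := spectral_unit B.
have PV : invmx P = (map_mx Num.conj P)^T.
  by rewrite invmx_unitary ?spectral_unitarymx // map_trmx.
have BE : B = invmx P *m diag_mx d *m P.
  exact/orthomx_spectralP/hermitian_normalmx.
have dE i : d 0 i = f (Re (d 0 i)).
  by rewrite /f RRe_real //; apply/mxOverP/hermitian_spectral_diag_real.
(* From P B = diag(d) P, row i of P is a left eigenvector of B for d_i. It is nonzero because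
   multiplying it by P^-1 gives row i of the identity. *)
have eig i : eigenvalue A (Re (d 0 i)).
  rewrite -(eigenvalue_map f) -/B (_ : _ (Re _) = d 0 i); last exact/esym/dE.
  apply/eigenvalueP; exists (row i P).
    by rewrite -row_mul BE !mulmxA mulmxV // mul1mx row_mul row_diag_mx
      -scalemxAl -rowE.
  apply/eqP => /(congr1 (mulmx^~ (invmx P))).
  rewrite -row_mul mulmxV // mul0mx => /rowP/(_ i)/eqP.
  by rewrite !mxE eqxx oner_eq0.
pose i0 := Ordinal n_gt0.
case: (@Order.TotalTheory.arg_maxP _ _ _ i0 xpredT (fun i => Re (d 0 i)) isT) => m _ dm.
exists (Re (d 0 m)); first exact: eig.
move=> Z Zpos.
pose q i := (P *m map_mx f Z *m invmx P) i i.
(* As P^-1 is the conjugate transpose of P, q_i is the sesquilinear form of Z at row i of P. *)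
have qE i : q i =
    (row i P *m map_mx f Z *m (map_mx Num.conj (row i P))^T) 0 0.
  rewrite /q PV -row_mul !mxE; apply: eq_bigr => j _.
  by rewrite !mxE.
have q_ge0 i : 0 <= Re (q i) by rewrite qE Re_hermitian_form_ge0.
have trZ : \tr Z = \sum_i Re (q i).
  rewrite -(raddf_sum (@Re R : Rcomplex R -> R)) -/(mxtrace _).
  by rewrite mxtrace_mulC mulKmx // trace_map_mx.
have trAZ : \tr (A *m Z) = \sum_i Re (d 0 i) * Re (q i).
  transitivity (Re (\tr (B *m map_mx f Z))).
    by rewrite -map_mxM trace_map_mx.
  (* Moving P^-1 cyclically to the end leaves the diagonal entries d_i q_i, and d_i real gives Re
     (d_i q_i) = d_i Re q_i. *)
  rewrite BE -!mulmxA mxtrace_mulC -!mulmxA (raddf_sum (@Re R : Rcomplex R -> R)).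
  apply: eq_bigr => i _; rewrite mul_diag_mx mxE {1}dE mulmxA -/(q i).
  by case: (q i) => x y /=; rewrite mul0r subr0.
rewrite trAZ trZ mulr_sumr; apply: ler_sum => i _.
by rewrite ler_wpM2r //; exact: dm.
Qed.
End Spectral.

Lemma outer_form_ge0 (R : realDomainType) (n : nat) (v : 'rV[R]_n) (x : 'cV[R]_n) :
  0 <= (x^T *m (v^T *m v) *m x) 0 0.
Proof.
rewrite mulmxA -trmx_mul -mulmxA mxE big_ord1 mxE.
exact: sqr_ge0.
Qed.

Lemma trace_outer_gt0 (R : realDomainType) (n : nat) (v : 'rV[R]_n) :
  v != 0 -> 0 < \tr (v^T *m v).
Proof.
have trE : \tr (v^T *m v) = \sum_i v 0 i ^+ 2.
  by apply: eq_bigr => i _; rewrite mxE big_ord1 mxE.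
rewrite trE lt0r sumr_ge0 ?andbT => [|i _]; last exact: sqr_ge0.
apply: contra_neq => /eqP; rewrite psumr_eq0 => [/allP v0|i _]; last exact: sqr_ge0.
apply/rowP => i; have := v0 i (mem_index_enum _).
by rewrite sqrf_eq0 mxE => /eqP.
Qed.

Lemma lambda_max_symmetric (R : realType) (n : nat) (A : 'M[R]_n) :
    (0 < n)%N -> A \is symmetricmx ->
  eigenvalue A (lambda_max A) /\
  forall Z : 'M[R]_n, psdmx Z -> \tr (A *m Z) <= lambda_max A * \tr Z.
Proof.
move=> n_gt0 Asym.
have [a aA aub] := symmetric_max_eigenvalue n_gt0 Asym.
suff -> : lambda_max A = a by split=> // Z [_ /aub].
(* Testing the trace bound on v^T v, for an eigenvector v of b, gives b |v|^2 <= a |v|^2. *)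
have a_ub : ubound [set b : R | eigenvalue A b]%classic a.
  move=> b /eigenvalueP[v vA v_neq0].
  have := aub (v^T *m v) (outer_form_ge0 v).
  rewrite mxtrace_mulC -mulmxA vA -scalemxAr mxtraceZ mxtrace_mulC.
  by rewrite mxtrace_mulC ler_pM2r ?trace_outer_gt0.
apply/le_anti/andP; split; first by apply: ge_sup => //; exists a.
by apply: ub_le_sup => //; exists a.
Qed.

Lemma laplacian_sym (R : realType) (n : nat) (e : rel 'I_n) :
  symmetric e -> laplacian R e \is symmetricmx.
Proof.
move=> e_sym; rewrite symmetricmxE; apply/eqP/matrixP => i j.
by rewrite !mxE e_sym; case: eqVneq => [->|].
Qed.

Lemma laplacian_mul_const1 (R : realType) (n : nat) (e : rel 'I_n) :
  laplacian R e *m const_mx 1 = 0 :> 'M[R]_n.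
Proof.
apply/matrixP => i j; rewrite mulmxBl mul_diag_mx !mxE mulr1.
by apply/eqP; rewrite subr_eq0; apply/eqP/eq_bigr => l _; rewrite !mxE.
Qed.

Theorem theorem3 (R : realType) (n k : nat) (e : rel 'I_n)
    (e_sym : symmetric e) (e_irr : irreflexive e)
    (k_ge2 : (2 <= k)%N) (k_le_n : (k <= n)%N) :
  is_max (sdp_values k (laplacian R e))
    (n%:R * (k%:R - 1) / (2 * k%:R) * lambda_max (laplacian R e)).
Proof.
set L := laplacian R e; set J : 'M[R]_n := const_mx 1.
have n_gt0 : (0 < n)%N by rewrite (leq_trans _ k_le_n) // (leq_trans _ k_ge2).
have k_gt0 : 0 < k%:R :> R by rewrite ltr0n (leq_trans _ k_ge2).
have k_neq0 : k%:R != 0 :> R by rewrite gt_eqF.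
have [/eigenvalueP[v vL v_neq0] Lub] :=
  lambda_max_symmetric n_gt0 (laplacian_sym R e_sym).
have trJ : \tr J = n%:R.
  by rewrite /mxtrace; under eq_bigr do rewrite mxE; rewrite sumr_const card_ord.
have trv_gt0 := trace_outer_gt0 v_neq0.
split; last first.
  move=> _ [Y [_ trY Ypsd] <-].
  (* The bound is applied to Z = kY - J, whose trace is kn - n. *)
  have := Lub _ Ypsd.
  rewrite mulmxBr laplacian_mul_const1 subr0 -scalemxAr mxtraceZ.
  rewrite raddfB /= mxtraceZ trY trJ => le_tr.
  rewrite -(ler_pM2l k_gt0); apply: (@le_trans _ _ (2^-1 * (k%:R * \tr (L *m Y)))).
    by rewrite mulrCA.
  apply: le_trans (ler_wpM2l _ le_tr) _; first by rewrite invr_ge0.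
  rewrite le_eqVlt; apply/orP; left; apply/eqP; field.
  by rewrite k_neq0.
(* This scaling makes tr Z = n (k - 1) for Z = c v^T v, which is what tr Y = n requires. *)
pose c : R := n%:R * (k%:R - 1) / \tr (v^T *m v).
have c_ge0 : 0 <= c.
  by rewrite divr_ge0 ?(ltW trv_gt0) // mulr_ge0 // subr_ge0 ler1n (leq_trans _ k_ge2).
pose Z := c *: (v^T *m v).
have Zsym : Z^T = Z by rewrite /Z linearZ /= trmx_mul trmxK.
have Jsym : J^T = J by rewrite trmx_const.
exists (k%:R^-1 *: (J + Z)); last first.
  rewrite -scalemxAr mulmxDr laplacian_mul_const1 add0r -scalemxAr !mxtraceZ.
  (* Cyclicity brings L to the right of the row eigenvector v, where it acts as the scalar
     [lambda_max L]. *)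
  rewrite mxtrace_mulC -mulmxA vL -scalemxAr mxtraceZ.
  rewrite /c; field.
  by rewrite k_neq0 gt_eqF.
split.
- by rewrite symmetricmxE [_^T]linearZ /= [_^T]linearD /= Jsym Zsym.
- rewrite mxtraceZ mxtraceD mxtraceZ trJ /c; field.
  by rewrite k_neq0 gt_eqF.
(* Here kY - J collapses to Z, a nonnegative multiple of v^T v. *)
rewrite scalerA divff // scale1r addrAC subrr add0r; split.
  by rewrite symmetricmxE Zsym.
move=> x; rewrite -scalemxAr -scalemxAl mxE mulr_ge0 //.
exact: outer_form_ge0.
Qed.
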